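(* Let $C\subset\mathbb{A}^2$ be an irreducible curve defined over a number field, let $\mathbb{L}$ be a number field over which $C$ is defined, and fix two positive integers $s=(s_0,s_1)$. For each place $v$ of $\mathbb{L}$ set $g_{s,v}(c,a):=\max\{s_0g_{0,v}(c,a),s_1g_{1,v}(c,a)\}$. Then there exists an integer $q\ge1$ such that, for all but finitely many places $v$ of $\mathbb{L}$, $$g_{s,v}(c,a)=\frac{1}{3^q}\max\{s_0\log^+|P^q_{c,a}(c_0)|_v,\ s_1\log^+|P^q_{c,a}(c_1)|_v\}$$ for all points $(c,a)$ of $C$ over $\mathbb{L}_v$.
   Context: $P_{c,a}(z)=\frac13z^3-\frac c2z^2+a^3$ with critical points $c_0=0$, $c_1=c$; $g_{i,v}(c,a)=\lim_n3^{-n}\log\max\{1,|P^n_{c,a}(c_i)|_v\}$ for $i=0,1$; $\log^+x=\max\{0,\log x\}$. *)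

(* Defs.v *)
From HB Require Import structures.
From mathcomp Require Import all_boot all_order all_algebra all_field.
From mathcomp Require Import all_classical all_reals all_analysis.
Set Implicit Arguments. Unset Strict Implicit. Unset Printing Implicit Defensive.
Import Order.TTheory GRing.Theory Num.Theory.
Import numFieldNormedType.Exports.
Local Open Scope ring_scope.

Section Defs.
Variable R : realType.

Definition is_absval (F : fieldType) (v : F -> R) : Prop :=
  [/\ forall x, 0 <= v x,
      forall x, v x = 0 <-> x = 0,
      forall x y, v (x * y) = v x * v y &
      forall x y, v (x + y) <= v x + v y].

Definition nontrivial_absval (F : fieldType) (v : F -> R) : Prop :=
  is_absval v /\ exists x : F, x != 0 /\ v x != 1.

(* equivalence of absolute values; a place is an equivalence class *)
Definition equiv_absval (F : fieldType) (v w : F -> R) : Prop :=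
  exists2 t : R, 0 < t & forall x, w x = powR (v x) t.

Definition is_completion (L K : fieldType) (v : L -> R) (w : K -> R)
    (iota : {rmorphism L -> K}) : Prop :=
  [/\ is_absval w,
      forall x, w (iota x) = v x,
      (forall u : nat -> K,
          (forall e : R, 0 < e -> exists N : nat, forall m n : nat,
               (N <= m)%N -> (N <= n)%N -> w (u m - u n) < e) ->
          exists l : K, forall e : R, 0 < e -> exists N : nat, forall n : nat,
               (N <= n)%N -> w (u n - l) < e) &
      forall (x : K) (e : R), 0 < e -> exists y : L, w (x - iota y) < e].

Definition Pca (K : fieldType) (c a z : K) : K :=
  z ^+ 3 / 3%:R - c * z ^+ 2 / 2%:R + a ^+ 3.

Definition crit (K : fieldType) (i : bool) (c : K) : K := if i then c else 0.

Definition logplus (x : R) : R := Num.max 0 (ln x).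

Definition green (K : fieldType) (w : K -> R) (i : bool) (c a : K) : R :=
  let u : nat -> R := fun n : nat =>
    (3%:R ^+ n)^-1 * ln (Num.max 1 (w (iter n (Pca c a) (crit i c)))) in
  limn u.

Definition green_s (K : fieldType) (w : K -> R) (s0 s1 : nat) (c a : K) : R :=
  Num.max (s0%:R * green w false c a) (s1%:R * green w true c a).

End Defs.

(* evaluation of F in K[c][a] (inner variable c, outer variable a) at (c,a) *)
Definition eval2 (K : nzRingType) (F : {poly {poly K}}) (c a : K) : K :=
  (F.[a%:P]).[c].

Definition is_const2 (K : nzRingType) (G : {poly {poly K}}) : bool :=
  (size G <= 1)%N && (size (nth 0%R G 0) <= 1)%N.

Definition irreducible2 (K : fieldType) (F : {poly {poly K}}) : Prop :=
  ~~ is_const2 F /\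
  forall G H : {poly {poly K}}, F = G * H -> is_const2 G \/ is_const2 H.

Definition abs_irreducible2 (K : fieldType) (F : {poly {poly K}}) : Prop :=
  forall (K' : fieldType) (f : {rmorphism K -> K'}),
    irreducible2 (map_poly (map_poly f) F).

(* Main.v *)
(** The formula holds at every point of the plane, as soon as [v] is
    non-archimedean with [|2| = |3| = 1]. Put [M = max(1, |c|, |a|)]. If
    [|z| > M] then [|P z| = |z|^3], so the Green function of an orbit is read off
    as soon as it leaves the disc of radius [M]; an orbit still inside that disc
    at time [q] has Green function at most [3^-q log M]. Since
    [P 0 = a^3] and [P c = a^3 - c^3/6], one of the two critical values has
    absolute value [M^3] when [M > 1], and its Green function is [log M]. Once
    [3^q >= max(s0, s1)], a slow critical point is therefore dominated by the
    fast one on both sides of the formula.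

    The excluded places are those where [|2|] or [|3|] differs from [1]. They lie
    over the places infinity, 2 and 3 of the rationals. Over each of these there
    are at most [[L : Q]] places, because elements separating inequivalent
    absolute values in the sense of Artin and Whaples are linearly independent
    over the rationals. *)

Require Import Defs.
From HB Require Import structures.
From mathcomp Require Import all_boot all_order all_algebra all_field.
From mathcomp Require Import all_classical all_reals all_analysis.
From mathcomp Require Import ring lra zify.
Import Order.TTheory GRing.Theory Num.Theory.
Import numFieldNormedType.Exports.
Local Open Scope ring_scope.
Set Implicit Arguments.
Unset Strict Implicit.

(** * Absolute values on a field *)

Lemma bernoulli_ineq (R : realFieldType) (h : R) (n : nat) :
  0 <= h -> 1 + h *+ n <= (1 + h) ^+ n.
Proof.
move=> h0; elim: n => [|n IH]; first by rewrite mulr0n addr0 expr0.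
have := ler_wpM2l (addr_ge0 ler01 h0) IH; rewrite exprS; apply: le_trans.
have hn : 0 <= h * (h *+ n) by rewrite mulr_ge0 ?mulrn_wge0.
rewrite mulrS; nra.
Qed.

(** This removes constants from estimates obtained by taking powers. If [x = 1 + h] with [h > 0],
    squaring the Bernoulli bound gives quadratic growth, which beats any linear bound. *)
Lemma le1_of_expr_le_linear (R : archiRealFieldType) (x C : R) :
  0 <= x -> 0 <= C -> (forall j, x ^+ j <= C * j.+1%:R) -> x <= 1.
Proof.
move=> x0 C0 H; rewrite leNgt; apply/negP => x1.
pose h := x - 1; have h0 : 0 < h by rewrite subr_gt0.
(* With [i * h^2 > 3 * C] and [i >= 1], the exponent [2i] gives
   [(h * i)^2 > 3 * C * i >= C * (2i + 1)]. *)
pose i := (Num.bound (3 * C / h ^+ 2)).+1.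
have hi : 3 * C / h ^+ 2 < i%:R.
  apply: lt_trans (archi_boundP _) _; last by rewrite ltr_nat.
  by rewrite divr_ge0 ?mulr_ge0 ?exprn_ge0 // ltW.
rewrite ltr_pdivrMr ?exprn_gt0 // in hi.
have B : h * i%:R <= x ^+ i.
  have := @bernoulli_ineq _ h i (ltW h0); rewrite (_ : 1 + h = x) /h; last by ring.
  by rewrite -[_ *+ i]mulr_natr; apply: le_trans; rewrite lerDr.
have := H (i * 2)%N; rewrite exprM.
have i1 : (1 : R) <= i%:R by rewrite ler1n.
have B2 : (h * i%:R) ^+ 2 <= (x ^+ i) ^+ 2.
  by rewrite lerXn2r ?nnegrE ?exprn_ge0 ?mulr_ge0 // ltW.
have -> : (i * 2).+1%:R = 2 * i%:R + 1 :> R.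
  by rewrite -addn1 natrD natrM mulrC.
move/(le_trans B2); rewrite leNgt => /negP; apply.
have := ltr_pM2l (lt_le_trans ltr01 i1) (3 * C) (i%:R * h ^+ 2).
rewrite hi exprMn => K.
have : C * (2 * i%:R + 1) <= i%:R * (3 * C) by nra.
move=> /le_lt_trans; apply; apply: lt_le_trans K _.
by rewrite mulrA mulrC -expr2.
Qed.

Section AbsVal.
Variables (R : realType) (F : fieldType) (v : F -> R).
Hypothesis hv : is_absval v.

Lemma absval_ge0 x : 0 <= v x. Proof. by case: hv. Qed.

Lemma absvalM x y : v (x * y) = v x * v y. Proof. by case: hv. Qed.

Lemma absvalD x y : v (x + y) <= v x + v y. Proof. by case: hv. Qed.

Lemma absval_eq0 x : (v x == 0) = (x == 0).
Proof. by case: hv => _ H _ _; apply/eqP/eqP => /H. Qed.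

Lemma absval0 : v 0 = 0. Proof. by apply/eqP; rewrite absval_eq0. Qed.

Lemma absval_gt0 x : (0 < v x) = (x != 0).
Proof. by rewrite lt_def absval_ge0 andbT absval_eq0. Qed.

Lemma absval1 : v 1 = 1.
Proof.
apply: (@mulfI _ (v 1)); first by rewrite absval_eq0 oner_eq0.
by rewrite -absvalM !mulr1.
Qed.

Lemma absvalX x n : v (x ^+ n) = v x ^+ n.
Proof. by elim: n => [|n IH]; rewrite ?expr0 ?absval1 // !exprS absvalM IH. Qed.

Lemma absvalV x : v x^-1 = (v x)^-1.
Proof.
have [->|x0] := eqVneq x 0; first by rewrite invr0 absval0 invr0.
apply: (@mulfI _ (v x)); first by rewrite absval_eq0.
by rewrite -absvalM !divff ?absval1 // absval_eq0.
Qed.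

Lemma absvalXz x (n : int) : v (x ^ n) = v x ^ n.
Proof. by case: n => n /=; rewrite ?NegzE -?exprnN -?exprnP ?absvalV absvalX. Qed.

Lemma absvalN x : v (- x) = v x.
Proof.
have : v (-1) ^+ 2 = 1 by rewrite -absvalX sqrrN expr1n absval1.
move/eqP; rewrite sqrf_eq1 => /orP[]/eqP E; first by rewrite -mulN1r absvalM E mul1r.
by have := absval_ge0 (-1); rewrite E oppr_ge0 ler10.
Qed.

Lemma absvalB x y : v x - v y <= v (x + y).
Proof.
by rewrite lerBlDr; have := absvalD (x + y) (- y); rewrite addrK absvalN.
Qed.

Lemma absval_nat n : v n%:R <= n%:R.
Proof.
elim: n => [|n IH]; first by rewrite absval0.
by rewrite -!natr1 (le_trans (absvalD _ _)) // absval1 lerD2r.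
Qed.

Lemma absval_sum (I : Type) (r : seq I) (P : pred I) (f : I -> F) :
  v (\sum_(i <- r | P i) f i) <= \sum_(i <- r | P i) v (f i).
Proof.
elim/big_rec2: _ => [|i y x _ h]; first by rewrite absval0.
by apply: le_trans (absvalD _ _) _; rewrite lerD2l.
Qed.

(* Writing N in base n bounds v N by the number of digits. *)
Lemma absval_digits (n k N : nat) : (1 < n)%N -> (N < n ^ k)%N ->
  v N%:R <= k%:R * n%:R * Num.max 1 (v n%:R) ^+ k.
Proof.
move=> n1; set A := Num.max 1 _.
have A1 : 1 <= A by rewrite le_max lexx.
have vA : v n%:R <= A by rewrite le_max lexx orbT.
elim: k N => [|k IH] N.
  by rewrite expn0 ltnS leqn0 => /eqP->; rewrite absval0 !mul0r.
move=> hN; rewrite {1}(divn_eq N n) natrD natrM.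
have hd : (N %/ n < n ^ k)%N by rewrite ltn_divLR -?expnSr //; lia.
apply: le_trans (absvalD _ _) _; rewrite absvalM.
have h1 : v (N %/ n)%:R * v n%:R <= k%:R * n%:R * A ^+ k * A.
  by apply: ler_pM; rewrite ?absval_ge0 ?IH.
have h2 : v (N %% n)%:R <= n%:R * A ^+ k.+1.
  apply: le_trans (absval_nat _) _; rewrite -[leLHS]mulr1.
  by apply: ler_pM; rewrite ?exprn_ege1 // ler_nat ltnW // ltn_mod; lia.
apply: le_trans (lerD h1 h2) _.
by rewrite -mulrA -exprSr -natr1 !mulrDl mul1r.
Qed.

(** Ostrowski's argument: apply the digit bound to [m ^ j], which has at most [e * j + 1] digits in
    base [n]. The prefactor is linear in [j], so it disappears in the limit of [j]-th roots. *)
Lemma absval_nat_le (m n e : nat) : (1 < n)%N -> (m <= n ^ e)%N ->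
  v m%:R <= Num.max 1 (v n%:R) ^+ e.
Proof.
move=> n1 mn; set A := Num.max 1 _.
have A1 : 1 <= A by rewrite le_max lexx.
have A0 : 0 < A by apply: lt_le_trans A1.
have Ae0 : 0 < A ^+ e by rewrite exprn_gt0.
suff : v m%:R / A ^+ e <= 1 by rewrite ler_pdivrMr // mul1r.
apply: (@le1_of_expr_le_linear _ _ (e.+1%:R * n%:R * A)).
- by rewrite divr_ge0 ?absval_ge0 // ltW.
- by rewrite !mulr_ge0 // ltW.
move=> j; rewrite expr_div_n ler_pdivrMr ?exprn_gt0 // -absvalX -natrX -exprM.
have h : (m ^ j < n ^ (e * j).+1)%N.
  apply: (@leq_ltn_trans (n ^ (e * j))%N); rewrite ?ltn_exp2l // expnM.
  by case: (j) => [|j']; rewrite ?expn0 // leq_exp2r.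
apply: le_trans (absval_digits n1 h) _; rewrite exprS -/A.
set X := A ^+ (e * j).
have X0 : 0 <= X by rewrite exprn_ge0 // ltW.
have : ((e * j).+1%:R : R) <= e.+1%:R * j.+1%:R by rewrite -natrM ler_nat; lia.
move=> K; rewrite [X in _ <= X](_ : _ = (e.+1%:R * j.+1%:R) * (n%:R * (A * X))); last by ring.
by rewrite -mulrA ler_wpM2r // !mulr_ge0 // ltW.
Qed.

Lemma absval_nat_le1 (n : nat) : (1 < n)%N -> v n%:R <= 1 ->
  forall m : nat, v m%:R <= 1.
Proof.
move=> n1 hn m; have := @absval_nat_le m n m n1 (ltnW (ltn_expl m n1)).
by rewrite max_l // expr1n.
Qed.

(** In the binomial expansion of [(x + y) ^ j] the coefficients have absolute value at most 1, so
    each of the [j + 1] terms is at most [M ^ j]; the linear factor is then removed by taking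
    powers. *)
Lemma absval_ultrametric : (forall m : nat, v m%:R <= 1) ->
  forall x y, v (x + y) <= Num.max (v x) (v y).
Proof.
move=> hm x y; set M := Num.max _ _.
have Mx : v x <= M by rewrite le_max lexx.
have My : v y <= M by rewrite le_max lexx orbT.
have [M0|M0] := eqVneq M 0.
  have z0 t : v t <= M -> t = 0.
    move=> h; apply/eqP; rewrite -absval_eq0; have := absval_ge0 t; lra.
  by rewrite (z0 x Mx) (z0 y My) addr0 absval0 M0.
have {}M0 : 0 < M by rewrite lt_def M0 (le_trans (absval_ge0 x)).
suff : v (x + y) / M <= 1 by rewrite ler_pdivrMr // mul1r.
apply: (@le1_of_expr_le_linear _ _ 1) => //.
  by rewrite divr_ge0 ?absval_ge0 // ltW.
move=> j; rewrite expr_div_n ler_pdivrMr ?exprn_gt0 // -absvalX exprDn mul1r.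
apply: le_trans (absval_sum _ _ _) _.
apply: (@le_trans _ _ (\sum_(i < j.+1) M ^+ j)); last first.
  by rewrite sumr_const card_ord mulr_natl.
apply: ler_sum => i _; rewrite -mulr_natr !absvalM !absvalX.
rewrite -[leRHS]mulr1; apply: ler_pM; rewrite ?hm ?mulr_ge0 ?exprn_ge0 ?absval_ge0 //.
have -> : M ^+ j = M ^+ (j - i) * M ^+ i by rewrite -exprD subnK // -ltnS.
by apply: ler_pM; rewrite ?exprn_ge0 ?absval_ge0 ?lerXn2r ?nnegrE ?absval_ge0 // ltW.
Qed.

Lemma absval_ultrametric_eq : (forall m : nat, v m%:R <= 1) ->
  forall x y, v y < v x -> v (x + y) = v x.
Proof.
move=> hm x y hxy; apply/eqP; rewrite eq_le; apply/andP; split.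
  by have := absval_ultrametric hm x y; rewrite max_l // ltW.
have := absval_ultrametric hm (x + y) (- y); rewrite addrK absvalN le_max.
by case/orP => // h; rewrite leNgt (lt_le_trans hxy) // in h *.
Qed.

End AbsVal.

(** * Separation of inequivalent absolute values *)

Lemma ln_exprz (R : realType) (x : R) (n : int) :
  0 < x -> ln (x ^ n) = n%:~R * ln x.
Proof.
move=> x0; case: n => n; first by rewrite -exprnP lnXn // -mulr_natl.
by rewrite NegzE -exprnN lnV ?posrE ?exprn_gt0 // lnXn // mulrNz mulNr -mulr_natl.
Qed.

Lemma ln_lt0E (R : realType) (x : R) : 0 < x -> (ln x < 0) = (x < 1).
Proof. by move=> x0; rewrite -{1}ln1 ltr_ln ?posrE. Qed.

Section Equivalence.
Local Open Scope classical_set_scope.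
Local Open Scope ring_scope.
Variables (R : realType) (F : fieldType).
Implicit Types v w : F -> R.

Lemma equiv_absval_sym v w : is_absval v -> equiv_absval v w -> equiv_absval w v.
Proof.
move=> hv [t t0 h]; exists t^-1; first by rewrite invr_gt0.
by move=> x; rewrite h -powRrM divff ?gt_eqF // powRr1 // absval_ge0.
Qed.

Lemma nontrivial_absval_lt1 v : nontrivial_absval v -> exists2 x, x != 0 & v x < 1.
Proof.
case=> hv [x [x0]]; rewrite neq_lt => /orP[h|h]; first by exists x.
by exists x^-1; rewrite ?invr_eq0 // (absvalV hv) invf_lt1 // absval_gt0.
Qed.

(** Testing the hypothesis on quotients [y^m / x0^n] compares the ratio [ln (v y) / ln (v x0)] with
    every rational, so it agrees with the same ratio for [w]; the exponent is
    [ln (w x0) / ln (v x0)]. *)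
Lemma absval_equivP v w : nontrivial_absval v -> is_absval w ->
  (forall x, v x < 1 -> w x < 1) -> equiv_absval v w.
Proof.
move=> nv hw vw; have hv := nv.1; have [x0 x0n vx0] := nontrivial_absval_lt1 nv.
have p (u : F -> R) (hu : is_absval u) x : x != 0 -> 0 < u x.
  by rewrite absval_gt0.
have a0 : ln (v x0) < 0 by rewrite ln_lt0E ?p.
have b0 : ln (w x0) < 0 by rewrite ln_lt0E ?p // vw.
have le y : y != 0 -> ln (v y) / ln (v x0) <= ln (w y) / ln (w x0).
  move=> yn; rewrite leNgt; apply/negP => /rat_in_itvoo[r].
  rewrite in_itv /= => /andP[rb ra].
  have d0 : (0 : R) < (denq r)%:~R by rewrite ltr0z denq_gt0.
  have rE : ratr r * (denq r)%:~R = (numq r)%:~R :> R.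
    by rewrite /ratr divfK // gt_eqF.
  (* Dividing by the negative [ln (u x0)] reverses the inequality; a rational strictly between the
     two ratios would then contradict the hypothesis. *)
  have key (u : F -> R) : is_absval u -> ln (u x0) < 0 ->
      (u (y ^ denq r / x0 ^ numq r) < 1) = (ratr r < ln (u y) / ln (u x0)).
    move=> hu u0; rewrite (absvalM hu) (absvalV hu) !(absvalXz hu).
    have uy := p u hu y yn; have ux := p u hu x0 x0n.
    rewrite -ln_lt0E ?mulr_gt0 ?invr_gt0 ?exprz_gt0 //.
    rewrite lnM ?lnV ?posrE ?invr_gt0 ?exprz_gt0 // !ln_exprz // -rE.
    rewrite subr_lt0 ltr_ndivlMr // [X in _ < X](_ : _ = (denq r)%:~R * (ratr r * ln (u x0))); last by ring.
    by rewrite ltr_pM2l.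
  move: ra; rewrite -key // => /vw; rewrite key // => rb'.
  by have := lt_trans rb rb'; rewrite ltxx.
have eq y : y != 0 -> ln (w y) = ln (w x0) / ln (v x0) * ln (v y).
  (* Applying [le] to the inverse of [y] gives the reverse inequality. *)
  move=> yn; have h1 := le _ yn; have yVn : y^-1 != 0 by rewrite invr_eq0.
  have := le _ yVn; rewrite (absvalV hv) (absvalV hw) !lnV ?posrE ?p // !mulNr lerN2 => h2.
  have E : ln (v y) / ln (v x0) = ln (w y) / ln (w x0) by apply/eqP; rewrite eq_le h1.
  rewrite mulrAC -mulrA E mulrC divfK // lt_eqF //.
exists (ln (w x0) / ln (v x0)); first by rewrite nmulr_rgt0 // invr_lt0.
move=> y; have [->|yn] := eqVneq y 0.
  by rewrite (absval0 hv) (absval0 hw) powR0 // mulf_neq0 ?invr_neq0 // lt_eqF.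
by apply: ln_inj; rewrite ?posrE ?powR_gt0 ?p // ln_powR eq.
Qed.

(** Inequivalence in both directions yields [x] with [v x < 1 <= w x] and [y] with [w y < 1 <= v y];
    the quotient [y / x] separates. *)
Lemma absval_separate v w : nontrivial_absval v -> nontrivial_absval w ->
  ~ equiv_absval v w -> exists2 e, 1 < v e & w e < 1.
Proof.
move=> nv nw nvw; have hv := nv.1; have hw := nw.1.
have [x vx wx] : exists2 x, v x < 1 & 1 <= w x.
  apply: contrapT => h; apply: nvw; apply: absval_equivP => // x vx.
  by rewrite ltNge; apply/negP => wx; apply: h; exists x.
have [y wy vy] : exists2 y, w y < 1 & 1 <= v y.
  apply: contrapT => h; apply: nvw; apply: equiv_absval_sym => //.
  apply: absval_equivP => // y wy.
  by rewrite ltNge; apply/negP => vy; apply: h; exists y.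
have xn : x != 0 by rewrite -(absval_gt0 hw) (lt_le_trans ltr01).
exists (y / x).
  by rewrite (absvalM hv) (absvalV hv) ltr_pdivlMr ?absval_gt0 // mul1r (lt_le_trans vx).
by rewrite (absvalM hw) (absvalV hw) ltr_pdivrMr ?absval_gt0 // mul1r (lt_le_trans wy).
Qed.

Lemma near_expr_lt (x M : R) : 0 <= x < 1 -> 0 < M ->
  \forall k \near \oo, x ^+ k < M.
Proof.
move=> /andP[x0 x1] M0; have := @cvg_expr R x; rewrite ger0_norm // => /(_ x1) h.
exact: (cvgr_lt _ h).
Qed.

Lemma near_expr_gt (x M : R) : 1 < x -> \forall k \near \oo, M < x ^+ k.
Proof.
move=> x1; have x0 : 0 < x by apply: lt_trans x1.
have M0 : 0 < Num.max M 1 by rewrite lt_max ltr01 orbT.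
have h : 0 <= x^-1 < 1 by rewrite invr_ge0 ltW // invf_lt1.
have M0' : 0 < (Num.max M 1)^-1 by rewrite invr_gt0.
have := near_expr_lt h M0'; apply: filterS => k.
by rewrite exprVn ltf_pV2 ?posrE ?exprn_gt0 // gt_max => /andP[].
Qed.

Lemma near_all_seq (I : eqType) (s : seq I) (P : I -> nat -> Prop) :
  (forall i, i \in s -> \forall k \near \oo, P i k) ->
  \forall k \near \oo, forall i, i \in s -> P i k.
Proof.
elim: s => [|i s IH] h; first by apply: nearW.
have h1 := h i (mem_head _ _).
have h2 : \forall k \near \oo, forall j, j \in s -> P j k.
  by apply: IH => j js; apply: h; rewrite inE js orbT.
near=> k => j; rewrite inE => /orP[/eqP->|]; first by near: k.
by move: j; near: k.
Unshelve. all: by end_near.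
Qed.

(* Artin and Whaples: the factor a^k / (1 + a^k) tends to 1 where a is large
   and to 0 where a is small. *)
Lemma absval_separate_seq v (s : seq (F -> R)) : nontrivial_absval v ->
  (forall w, w \in s -> nontrivial_absval w /\ ~ equiv_absval v w) ->
  exists2 e, 1 < v e & forall w, w \in s -> w e < 1.
Proof.
move=> nv; have hv := nv.1; elim: s => [|w s IH] hs.
  have [x xn vx] := nontrivial_absval_lt1 nv.
  by exists x^-1 => //; rewrite (absvalV hv) invf_gt1 // absval_gt0.
have [a va sa] : exists2 e, 1 < v e & forall w, w \in s -> w e < 1.
  by apply: IH => u us; apply: hs; rewrite inE us orbT.
have [nw nvw] := hs w (mem_head _ _); have hw := nw.1.
have [b vb wb] := absval_separate nv nw nvw.
have hu u : u \in s -> is_absval u.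
  by move=> us; case: (hs u); rewrite ?inE ?us ?orbT // => -[].
(* This threshold serves both cases below: it gives [u a ^+ k * u b < 1], and also
   [u b * u a ^+ k < 1 - u a ^+ k]. *)
have h3 : \forall k \near \oo, forall u, u \in s -> u a ^+ k < (u b + 1)^-1.
  apply: near_all_seq => u us; apply: near_expr_lt.
    by rewrite sa // absval_ge0 //; exact: hu.
  by rewrite invr_gt0 ltr_wpDl ?absval_ge0 //; exact: hu.
(* If [w a <= 1], the factor [a ^+ k] keeps [b] small at [w] and large at [v], so [a ^+ k * b]
   suffices. *)
have [wa|wa] := leP (w a) 1.
  case: h3 => k _ /(_ k (leqnn k)) hk; exists (a ^+ k * b).
    by rewrite (absvalM hv) (absvalX hv) (lt_le_trans vb) // ler_peMl ?exprn_ege1 ?absval_ge0 // ltW.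
  move=> u; rewrite inE => /orP[/eqP->|us].
    rewrite (absvalM hw) (absvalX hw); apply: le_lt_trans wb.
    by rewrite ler_piMl ?absval_ge0 // exprn_ile1 ?absval_ge0.
  have huu := hu u us; have := hk u us; have ub := absval_ge0 huu b.
  rewrite (absvalM huu) (absvalX huu) -[X in _ < X]div1r ltr_pdivlMr; last by lra.
  have : 0 <= u a ^+ k by rewrite exprn_ge0 ?absval_ge0.
  by lra.
(* The two bounds rearrange to [v b * v a ^+ k > 1 + v a ^+ k] and
   [w b * w a ^+ k < w a ^+ k - 1]. *)
have h1 := near_expr_gt (v b - 1)^-1 va.
have h2 := near_expr_gt (1 - w b)^-1 wa.
have h4 : \forall k \near \oo, (0 < k)%N by exact: nbhs_infty_gt.
have [k [[k1 k2] [k3 k4]]] := filter_ex (filterI (filterI h1 h2) (filterI h3 h4)).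
have cn : 1 + a ^+ k != 0.
  rewrite -(absval_gt0 hv); have := absvalB hv (a ^+ k) 1.
  rewrite [_ + 1]addrC (absval1 hv) (absvalX hv); apply: lt_le_trans.
  by rewrite subr_gt0 exprn_egt1 // -lt0n.
exists (b * (a ^+ k / (1 + a ^+ k))).
  rewrite !(absvalM hv) (absvalV hv) (absvalX hv) mulrA ltr_pdivlMr ?absval_gt0 // mul1r.
  have := absvalD hv 1 (a ^+ k); rewrite (absval1 hv) (absvalX hv) => /le_lt_trans; apply.
  by move: k1; rewrite -div1r ltr_pdivrMr ?subr_gt0 //; lra.
move=> u; rewrite inE => /orP[/eqP->|us].
  rewrite !(absvalM hw) (absvalV hw) (absvalX hw) mulrA ltr_pdivrMr ?absval_gt0 // mul1r.
  have := absvalB hw (a ^+ k) 1; rewrite [_ + 1]addrC (absval1 hw) (absvalX hw); apply: lt_le_trans.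
  by move: k2; rewrite -div1r ltr_pdivrMr ?subr_gt0 //; lra.
have huu := hu u us; have := k3 u us; have ub := absval_ge0 huu b.
rewrite !(absvalM huu) (absvalV huu) (absvalX huu) mulrA ltr_pdivrMr ?absval_gt0 // mul1r.
have := absvalB huu 1 (a ^+ k); rewrite (absval1 huu) (absvalX huu) => h.
rewrite -[X in _ < X]div1r ltr_pdivlMr; last by lra.
move=> h5; apply: lt_le_trans h; lra.
Qed.

End Equivalence.

(** * Places of a number field *)

Lemma is_absval_comp (R : realType) (F E : fieldType) (f : {rmorphism F -> E})
    (v : E -> R) : is_absval v -> is_absval (v \o f).
Proof.
move=> hv; split=> [x|x|x y|x y] /=; first exact: absval_ge0.
- split=> [/eqP|->]; last by rewrite rmorph0 absval0.
  by rewrite absval_eq0 // fmorph_eq0 => /eqP.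
- by rewrite rmorphM absvalM.
- by rewrite rmorphD absvalD.
Qed.

(** * Absolute values on the rationals *)

Section AbsValRat.
Variables (R : realType) (v : rat -> R).
Hypothesis hv : is_absval v.

Lemma absval_int (n : int) : v n%:~R = v `|n|%N%:R.
Proof.
by case: n => n; rewrite ?NegzE ?abszN ?mulrNz ?(absvalN hv).
Qed.

Lemma absval_rat_mono :
  (forall m n : nat, (m <= n)%N -> v m%:R <= v n%:R) ->
  forall x y : rat, `|x| <= `|y| -> v x <= v y.
Proof.
move=> mono x y xy.
have dn (z : rat) : (denq z)%:~R != 0 :> rat by rewrite intr_eq0 denq_neq0.
have d0 (z : rat) : 0 < v (denq z)%:~R by rewrite absval_gt0.
have E (z t : rat) : v z * (v (denq z)%:~R * v (denq t)%:~R) =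
    v (`|numq z| * `|denq t|)%N%:R.
  rewrite -abszM -absval_int intrM (absvalM hv) mulrA -(absvalM hv z); congr (v _ * _).
  by rewrite numqE.
rewrite -(ler_pM2r (mulr_gt0 (d0 x) (d0 y))) E [v (denq x)%:~R * _]mulrC E.
apply: mono; rewrite -(ler_nat rat) !natrM !natr_absz !intr_norm !numqE !normrM.
by rewrite [leRHS]mulrAC !ler_wpM2r.
Qed.

(** An integer [n >= 2] with [v n <= 1] would force [v 2 <= 1]. Hence [v n > 1], and the Ostrowski
    bound with exponent 1 is monotonicity on the integers. *)
Lemma absval_arch_mono : 1 < v 2%:R ->
  forall x y : rat, `|x| <= `|y| -> v x <= v y.
Proof.
move=> v2; apply: absval_rat_mono => m n mn.
case: n mn => [|[|n]] mn; first by move: mn; rewrite leqn0 => /eqP->.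
  by rewrite (absval1 hv) (le_trans (absval_nat hv _)) // lern1.
have vn : 1 < v n.+2%:R.
  rewrite ltNge; apply/negP => h.
  by have := absval_nat_le1 hv (isT : (1 < n.+2)%N) h 2; rewrite leNgt v2.
have := @absval_nat_le _ _ _ hv m n.+2 1 isT; rewrite expn1 => /(_ mn).
by rewrite expr1 max_r // ltW.
Qed.

Lemma absval_padic_lt1 (p m : nat) : prime p -> v p%:R < 1 ->
  (v m%:R < 1) = (p %| m)%N.
Proof.
move=> pp vp; have le1 := absval_nat_le1 hv (prime_gt1 pp) (ltW vp).
apply/idP/idP => [vm|/dvdnP[k ->]]; last first.
  by rewrite natrM (absvalM hv) (le_lt_trans _ vp) // ler_piMl ?absval_ge0.
rewrite -[(_ %| _)%N]negbK -prime_coprime //; apply/negP => cop.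
have [m0|m0] := posnP m.
  by move: cop; rewrite m0 /coprime gcdn0; case: (p) pp => [|[]].
(* Bezout writes 1 as [k * m - b * p]; both terms would have absolute value below 1. *)
have [b _] := Bezoutr p m0; move: cop; rewrite /coprime => /eqP -> /dvdnP[k E].
have : v 1 <= Num.max (v (k * m)%N%:R) (v (- (b * p)%N%:R)).
  apply: le_trans (absval_ultrametric hv le1 _ _); rewrite -E natrD addrK.
  by rewrite lexx.
rewrite (absval1 hv) leNgt gt_max (absvalN hv) !natrM !(absvalM hv).
by apply/negP/negPn/andP; split; [apply: le_lt_trans vm|apply: le_lt_trans vp];
  rewrite ler_piMl ?absval_ge0.
Qed.

End AbsValRat.

(** It suffices to compare [z = x / y] with 1. In lowest terms, [v z <= 1] forces [p] not to divide
    the denominator, which therefore has [w]-value 1. *)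
Lemma absval_padic_mono (R : realType) (p : nat) (v w : rat -> R) :
  prime p -> is_absval v -> is_absval w -> v p%:R < 1 -> w p%:R < 1 ->
  forall x y, v x <= v y -> w x <= w y.
Proof.
move=> pp hv hw vp wp x y.
have [->|yn] := eqVneq y 0.
  rewrite (absval0 hv) => h; have : v x == 0 by rewrite eq_le h absval_ge0.
  by rewrite absval_eq0 // => /eqP->; rewrite lexx.
have {yn} red (u : rat -> R) : is_absval u -> (u x <= u y) = (u (x / y) <= 1).
  by move=> hu; rewrite (absvalM hu) (absvalV hu) ler_pdivrMr ?mul1r // absval_gt0.
rewrite !red //; set z := x / y.
have wle1 := absval_nat_le1 hw (prime_gt1 pp) (ltW wp).
have vle1 := absval_nat_le1 hv (prime_gt1 pp) (ltW vp).
have zE (u : rat -> R) : is_absval u -> u z = u `|numq z|%N%:R / u `|denq z|%N%:R.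
  by move=> hu; rewrite -{1}[z]divq_num_den (absvalM hu) (absvalV hu) !absval_int.
have dn : `|denq z|%N%:R != 0 :> rat by rewrite pnatr_eq0 absz_eq0 denq_neq0.
rewrite !zE // !ler_pdivrMr ?absval_gt0 // !mul1r => h.
have pd : ~~ (p %| `|denq z|)%N.
  apply/negP => pd; have pn : (p %| `|numq z|)%N.
    by rewrite -(absval_padic_lt1 hv _ pp vp) (le_lt_trans h) // (absval_padic_lt1 hv _ pp vp).
  have := dvdn_gcd p `|numq z| `|denq z|; rewrite pn pd.
  have /eqP-> := coprime_num_den z; rewrite dvdn1 => /eqP p1.
  by rewrite p1 in pp.
apply: le_trans (wle1 _) _; rewrite leNgt.
by rewrite (absval_padic_lt1 hw _ pp wp).
Qed.

(** * Finiteness of the places over a given place of the rationals *)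

Section NumberField.
Variables (R : realType) (L : fieldExtType rat).
Implicit Types (v w : L -> R) (rho : rat -> R).

(* Separating elements of inequivalent places over one place of the rationals
   are linearly independent over the rationals: in a relation, the term whose
   coefficient is largest dominates at its own place. *)
Lemma size_inequiv_le_dim rho (s : seq (L -> R)) : uniq s ->
  (forall v, v \in s -> nontrivial_absval v) ->
  (forall v, v \in s -> forall x y, rho x <= rho y -> v x%:A <= v y%:A) ->
  (forall v w, v \in s -> w \in s -> v != w -> ~ equiv_absval v w) ->
  (size s <= \dim {:L})%N.
Proof.
move=> us nt mono ineq.
have /choice[e he] v : exists x : L, v \in s ->
    1 < v x /\ forall w, w \in s -> v != w -> w x < 1.
  have [vs|_] := boolP (v \in s); last by exists 0.
  have [w|x vx hx] := @absval_separate_seq R L v [seq w <- s | v != w] (nt v vs).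
    by rewrite mem_filter => /andP[vw ws]; split; [exact: nt|exact: ineq].
  by exists x => _; split=> // w ws vw; apply: hx; rewrite mem_filter vw.
set n := size s.
(* With [1 / (n + 1)] as threshold, the other terms of a relation total at most [n / (n + 1)] of the
   largest coefficient, less than the dominant term. *)
have [k hk] : exists k, forall v, v \in s -> forall w, w \in s -> v != w ->
    w (e v) ^+ k < n.+1%:R^-1.
  suff [k _ hk] : (\forall k \near \oo, forall v, v \in s -> forall w, w \in s ->
      v != w -> w (e v) ^+ k < n.+1%:R^-1)%classic.
    by exists k; apply: (hk k (leqnn k)).
  apply: near_all_seq => v vs; apply: near_all_seq => w ws.
  have [->|vw] := eqVneq v w; first by apply: nearW.
  have := @near_expr_lt R (w (e v)) n.+1%:R^-1.
  rewrite absval_ge0 ?(he v vs).2 ?invr_gt0 //=; last exact: (nt w ws).1.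
  by move=> /(_ isT (ltr0Sn _ _)); apply: filterS.
pose X : n.-tuple L := [tuple of [seq e v ^+ k | v <- in_tuple s]].
suff /eqP fX : free X.
  have := dimvS (subvf <<X>>%VS); rewrite fX.
  by rewrite size_tuple.
apply/freeP => q sum0 i0; apply/eqP/negPn/negP => qi0.
pose d : L -> R := fun=> 0.
have XE (i : 'I_n) : X`_i = e (nth d s i) ^+ k by rewrite (nth_map d).
have [/= i _ imax] := @arg_maxP _ _ _ i0 xpredT (fun i => rho (q i)) isT.
have ins (j : 'I_n) : nth d s j \in s by exact: mem_nth.
set v := nth d s i; have vs : v \in s := ins i.
have hv := (nt v vs).1.
have qle j : v (q j)%:A <= v (q i)%:A by apply: mono => //; exact: imax.
have qi : 0 < v (q i)%:A.
  by apply: lt_le_trans (qle i0); rewrite absval_gt0 // scaler_eq0 oner_eq0 orbF.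
have : v (q i *: X`_i) <= \sum_(j < n | j != i) v (q j *: X`_j).
  move/eqP: sum0; rewrite (bigD1 i) //= addr_eq0 => /eqP->.
  by rewrite (absvalN hv) absval_sum.
apply/negP; rewrite -ltNge.
apply: (@le_lt_trans _ _ (\sum_(j < n) v (q i)%:A * n.+1%:R^-1)).
  rewrite [leRHS](bigD1 i) //= -[leLHS]add0r lerD //.
    by rewrite mulr_ge0 // ?ltW // invr_gt0.
  apply: ler_sum => j ji; rewrite -[q j *: _]mulr_algl (absvalM hv) XE (absvalX hv).
  apply: ler_pM; rewrite ?exprn_ge0 ?absval_ge0 //.
  by rewrite ltW // hk // nth_uniq.
rewrite sumr_const card_ord -[_ *+ n]mulr_natr -mulrA -[q i *: X`_i]mulr_algl (absvalM hv) ltr_pM2l //.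
apply: (@lt_le_trans _ _ 1); first by rewrite ltr_pdivrMl // mulr1 ltr_nat.
by rewrite XE (absvalX hv) exprn_ege1 // ltW // (he v vs).1.
Qed.

(** Otherwise inequivalent places could be added one at a time, beyond the dimension of [L] over the
    rationals. *)
Lemma finitely_many_places rho (P : (L -> R) -> Prop) :
  (forall v, P v -> nontrivial_absval v) ->
  (forall v, P v -> forall x y, rho x <= rho y -> v x%:A <= v y%:A) ->
  exists S : seq (L -> R), forall v, P v -> exists2 w, w \in S & equiv_absval w v.
Proof.
move=> nt mono; apply: contrapT => noS.
have new (S : seq (L -> R)) : exists2 v, P v & forall w, w \in S -> ~ equiv_absval w v.
  apply: contrapT => h; apply: noS; exists S => v Pv; apply: contrapT => h'.
  by apply: h; exists v => // w wS eq; apply: h'; exists w.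
have build n : exists s : seq (L -> R), [/\ size s = n, uniq s,
    forall v, v \in s -> P v &
    forall v w, v \in s -> w \in s -> v != w -> ~ equiv_absval v w].
  elim: n => [|n [s [sz us Ps ineq]]]; first by exists [::].
  have [v Pv nv] := new s; exists (v :: s); split=> //=; first by rewrite sz.
  - rewrite us andbT; apply/negP => vs; apply: (nv v vs); exists 1 => // x.
    by rewrite powRr1 // absval_ge0 //; exact: (nt v Pv).1.
  - by move=> w; rewrite inE => /orP[/eqP->|/Ps].
  - move=> u w; rewrite !inE => /orP[/eqP->|us'] /orP[/eqP->|ws]; rewrite ?eqxx //.
    + by move=> _ /equiv_absval_sym-/(_ (nt v Pv).1); exact: nv.
    + by move=> _; exact: nv.
    + exact: ineq.
have [s [sz us Ps ineq]] := build (\dim {:L}).+1.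
have := size_inequiv_le_dim us (fun v vs => nt v (Ps v vs)) (fun v vs => mono v (Ps v vs)) ineq.
by rewrite sz ltnn.
Qed.

Lemma finitely_many_padic_places (p : nat) : prime p ->
  exists S : seq (L -> R), forall v, nontrivial_absval v -> v p%:R < 1 ->
    exists2 w, w \in S & equiv_absval w v.
Proof.
move=> pp; pose P v := nontrivial_absval v /\ v p%:R < 1.
have [[v0 [nv0 v0p]]|none] := pselect (exists v, P v); last first.
  by exists [::] => v nv vp; case: none; exists v.
have natE v : v (in_alg L p%:R) = v p%:R by rewrite rmorph_nat.
(* The restriction to the rationals of any one place over [p] serves as the reference [rho]. *)
have [||S hS] := @finitely_many_places (v0 \o in_alg L) P.
- by move=> v [].
- move=> v [nv vp] x y; apply: (@absval_padic_mono _ p _ (v \o in_alg L)) => //=.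
  + exact: is_absval_comp nv0.1.
  + exact: is_absval_comp nv.1.
  + by rewrite natE.
  + by rewrite natE.
by exists S => v nv vp; apply: hS.
Qed.

Lemma finitely_many_arch_places :
  exists S : seq (L -> R), forall v, nontrivial_absval v -> 1 < v 2%:R ->
    exists2 w, w \in S & equiv_absval w v.
Proof.
have [||S hS] := @finitely_many_places (fun x => ratr `|x|)
    (fun v => nontrivial_absval v /\ 1 < v 2%:R).
- by move=> v [].
- move=> v [nv v2] x y; rewrite ler_rat.
  apply: (@absval_arch_mono _ (v \o in_alg L)); first exact: is_absval_comp nv.1.
  by rewrite /= scaler_nat.
by exists S => v nv vp; apply: hS.
Qed.

End NumberField.

(** * Escape rates at places of good reduction *)

Section GoodReduction.
Local Open Scope classical_set_scope.
Local Open Scope ring_scope.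
Variables (R : realType) (K : fieldType) (w : K -> R).
Hypothesis hw : is_absval w.
Hypothesis w_nat : forall m : nat, w m%:R <= 1.
Hypothesis w2 : w 2%:R = 1.
Hypothesis w3 : w 3%:R = 1.
Variables (c a : K) (M : R).
Hypothesis M1 : 1 <= M.
Hypothesis cM : w c <= M.
Hypothesis aM : w a <= M.

Let um := absval_ultrametric hw w_nat.

Let M_gt0 : 0 < M := lt_le_trans ltr01 M1.

Lemma w_Pca_lower (z : K) (B : R) : w z <= B -> M <= B ->
  w (- (c * z ^+ 2 / 2%:R) + a ^+ 3) <= M * B ^+ 2.
Proof.
move=> zB MB; have B0 : 0 <= B := le_trans (ltW M_gt0) MB.
apply: le_trans (um _ _) _; rewrite ge_max; apply/andP; split.
  rewrite (absvalN hw) 2!(absvalM hw) (absvalV hw) w2 invr1 mulr1 (absvalX hw).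
  by apply: ler_pM; rewrite ?exprn_ge0 ?absval_ge0 // lerXn2r ?nnegrE ?absval_ge0.
rewrite (absvalX hw) exprS; apply: ler_pM; rewrite ?exprn_ge0 ?absval_ge0 //.
by rewrite lerXn2r ?nnegrE ?absval_ge0 // (le_trans aM).
Qed.

Lemma w_cube3 (z : K) : w (z ^+ 3 / 3%:R) = w z ^+ 3.
Proof. by rewrite (absvalM hw) (absvalV hw) w3 invr1 mulr1 (absvalX hw). Qed.

Lemma w_Pca_le (z : K) (B : R) : w z <= B -> M <= B -> w (Pca c a z) <= B ^+ 3.
Proof.
move=> zB MB; have B0 : 0 <= B := le_trans (ltW M_gt0) MB.
rewrite /Pca -addrA; apply: le_trans (um _ _) _; rewrite ge_max w_cube3.
rewrite lerXn2r ?nnegrE ?absval_ge0 //=; apply: le_trans (w_Pca_lower zB MB) _.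
by rewrite [leRHS]exprS ler_wpM2r ?exprn_ge0.
Qed.

(** The remaining terms are at most [M * w z ^+ 2], strictly less than the cubic term. *)
Lemma w_Pca_escape (z : K) : M < w z -> w (Pca c a z) = w z ^+ 3.
Proof.
move=> Mz; rewrite /Pca -addrA (absval_ultrametric_eq hw w_nat) ?w_cube3 //.
apply: le_lt_trans (w_Pca_lower (lexx _) (ltW Mz)) _.
by rewrite [ltRHS]exprS ltr_pM2r // exprn_gt0 // (lt_trans M_gt0).
Qed.

Lemma w_iter_le (z : K) (k : nat) :
  w z <= M -> w (iter k (Pca c a) z) <= M ^+ (3 ^ k).
Proof.
move=> zM; elim: k => [|k IH] //=; rewrite expnSr exprM.
by apply: w_Pca_le => //; apply: ler_eXnr; rewrite ?expn_gt0.
Qed.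

Lemma w_iter_escape (z : K) (k : nat) :
  M < w z -> w (iter k (Pca c a) z) = w z ^+ (3 ^ k).
Proof.
move=> Mz; elim: k => [|k IH] //=; rewrite expnSr exprM -IH w_Pca_escape // IH.
by apply: lt_le_trans (Mz) _; apply: ler_eXnr; rewrite ?expn_gt0 // (ltW (le_lt_trans M1 Mz)).
Qed.

Let orb i n := iter n (Pca c a) (crit i c).

Lemma orbD i k n : orb i (k + n) = iter k (Pca c a) (orb i n).
Proof. by rewrite /orb iterD. Qed.

(** After escape each step multiplies the logarithm by exactly 3, so the sequence defining the limit
    is constant from [n] on. *)
Lemma green_escape i n : M < w (orb i n) ->
  green w i c a = (3%:R ^+ n)^-1 * ln (w (orb i n)).
Proof.
move=> Mn; rewrite /green /=; apply: lim_near_cst; first exact: Rhausdorff.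
exists n => // m /= nm; rewrite -(subnK nm) -/(orb i _) orbD w_iter_escape //.
set W := w _; have W1 : 1 <= W by apply: le_trans M1 (ltW Mn).
rewrite max_r ?exprn_ege1 // lnXn ?(lt_le_trans ltr01) // -[ln _ *+ _]mulr_natl natrX exprD.
by rewrite invfM mulrACA mulVf ?mul1r // expf_neq0.
Qed.

(** Escape is permanent, so it can only occur at some [m > n], where the orbit is at most
    [M ^+ (3 ^ (m - n))]. Without escape the defining sequence is squeezed to 0. *)
Lemma green_bounds i n : w (orb i n) <= M ->
  0 <= green w i c a <= (3%:R ^+ n)^-1 * ln M.
Proof.
move=> nM; have M0 := M_gt0.
have lnM0 : 0 <= ln M by rewrite ln_ge0.
have p3 m : 0 < (3%:R ^+ m : R)^-1 by rewrite invr_gt0 exprn_gt0.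
have [[m Mm]|none] := pselect (exists m, M < w (orb i m)).
  have W1 : 1 <= w (orb i m) by apply: le_trans M1 (ltW Mm).
  rewrite (green_escape Mm) mulr_ge0 ?ln_ge0 ?(ltW (p3 m)) //=.
  have [mn|nm] := leqP m n.
    move: nM; rewrite -(subnK mn) orbD w_iter_escape // leNgt => /negP[].
    by apply: lt_le_trans Mm _; apply: ler_eXnr; rewrite ?expn_gt0.
  have := w_iter_le (m - n) nM; rewrite -orbD subnK ?(ltnW nm) // => h.
  have : ln (w (orb i m)) <= ln (M ^+ (3 ^ (m - n))).
    by rewrite ler_ln ?posrE ?exprn_gt0 // (lt_le_trans ltr01).
  rewrite lnXn // -[ln _ *+ _]mulr_natl natrX => h'.
  rewrite ler_pdivrMl ?exprn_gt0 // (_ : 3 ^+ m = 3 ^+ (m - n) * 3 ^+ n); last first.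
    by rewrite -exprD subnK // ltnW.
  by rewrite -mulrA mulVKf // expf_neq0.
suff -> : green w i c a = 0 by rewrite lexx mulr_ge0 // ltW.
have le m : w (orb i m) <= M by rewrite leNgt; apply/negP => h; apply: none; exists m.
rewrite /green /=; apply: cvg_lim; first exact: Rhausdorff.
apply: (@squeeze_cvgr _ _ _ _ (fun=> 0) (fun m => (3%:R^-1) ^+ m * ln M)).
- apply: nearW => m; rewrite -/(orb i m) mulr_ge0 ?(ltW (p3 m)) ?ln_ge0 ?le_max ?lexx //=.
  rewrite exprVn ler_wpM2l ?(ltW (p3 m)) // ler_ln ?posrE ?lt_max ?ltr01 //.
  by rewrite ge_max M1 le.
- exact: cvg_cst.
- rewrite -[X in _ --> X](mul0r (ln M)); apply: cvgMl; apply: cvg_expr.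
  by rewrite ger0_norm ?invr_ge0 // invf_lt1 ?ltr1n.
Qed.

Lemma green_dichotomy i q :
  let l := (3%:R ^+ q)^-1 * logplus (w (orb i q)) in
  green w i c a = l \/
  0 <= green w i c a <= (3%:R ^+ q)^-1 * ln M /\ 0 <= l <= (3%:R ^+ q)^-1 * ln M.
Proof.
rewrite /= /logplus; have p3 : 0 < (3%:R ^+ q : R)^-1 by rewrite invr_gt0 exprn_gt0.
have [qM|Mq] := leP (w (orb i q)) M; [right | left]; last first.
  rewrite (green_escape Mq) max_r // ln_ge0 // (le_trans M1) // ltW //.
split; first exact: green_bounds.
have lnM0 : 0 <= ln M by rewrite ln_ge0.
rewrite mulr_ge0 ?(ltW p3) ?le_max ?lexx //= ler_pM2l // ge_max lnM0 /=.
(* An orbit point equal to 0 is covered by the convention that [ln 0] is 0. *)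
have [W0|W0] := eqVneq (w (orb i q)) 0; first by rewrite W0 ln0.
rewrite ler_ln ?posrE //; by rewrite lt_def W0 absval_ge0.
Qed.

(** Since [M ^+ 3 > M], the orbit has escaped by time 1 and has absolute value [M ^+ (3 ^ q)] at
    time [q]. *)
Lemma green_fast i q : (0 < q)%N -> 1 < M -> w (orb i 1) = M ^+ 3 ->
  green w i c a = ln M /\ (3%:R ^+ q)^-1 * logplus (w (orb i q)) = ln M.
Proof.
move=> q0 M1' E; have M0 := M_gt0.
have E' : w (orb i q) = M ^+ (3 ^ q).
  rewrite -(subnK q0) orbD w_iter_escape E -?exprM -?expnS ?addn1 //.
  by apply: ltr_eXnr.
have MM : M < w (orb i q).
  by rewrite E' -{1}[M]expr1 ltr_eXn2l // -{1}(expn0 3) ltn_exp2l.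
have lE : (3%:R ^+ q)^-1 * ln (w (orb i q)) = ln M.
  rewrite E' lnXn // -[ln _ *+ _]mulr_natl natrX mulrA mulVf ?mul1r // expf_neq0 //.
split; first by rewrite (green_escape MM).
by rewrite /logplus max_r // ln_ge0 // (le_trans M1) // ltW.
Qed.

End GoodReduction.

(** * Comparison of the two critical points *)

Lemma w_Pca_crit_max (R : realType) (K : fieldType) (w : K -> R) (c a : K) :
  is_absval w -> (forall m : nat, w m%:R <= 1) -> w 2%:R = 1 -> w 3%:R = 1 ->
  exists i, w (Pca c a (crit i c)) = Num.max (w c) (w a) ^+ 3.
Proof.
move=> hw w_nat w2 w3.
have n2 : 2%:R != 0 :> K by rewrite -(absval_gt0 hw) w2.
have n3 : 3%:R != 0 :> K by rewrite -(absval_gt0 hw) w3.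
(* Ties go to the critical point 0, so that for [c] the term [c^3 / 6] dominates [a^3] strictly and
   no cancellation occurs. *)
have [ca|ac] := leP (w c) (w a).
  exists false; rewrite /Pca /crit !expr0n /= !mul0r mulr0 mul0r subr0 add0r.
  by rewrite (absvalX hw).
exists true; rewrite /crit.
have -> : Pca c a c = - (c ^+ 3 / (2%:R * 3%:R)) + a ^+ 3 .
  by rewrite /Pca; field; rewrite n2 n3 (natrM _ 2 3) mulf_neq0.
have E : w (- (c ^+ 3 / (2%:R * 3%:R))) = w c ^+ 3.
  by rewrite (absvalN hw) (absvalM hw) (absvalV hw) (absvalM hw 2%:R) w2 w3 mulr1 invr1
     mulr1 (absvalX hw).
rewrite (absval_ultrametric_eq hw w_nat) E // (absvalX hw).
by rewrite ltrXn2r // absval_ge0.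
Qed.

Lemma green_s_formula (R : realType) (K : fieldType) (w : K -> R)
    (s0 s1 q : nat) (c a : K) :
  is_absval w -> (forall m : nat, w m%:R <= 1) -> w 2%:R = 1 -> w 3%:R = 1 ->
  (0 < s0 <= 3 ^ q)%N -> (0 < s1 <= 3 ^ q)%N -> (0 < q)%N ->
  green_s w s0 s1 c a =
  (3%:R ^+ q)^-1 *
    Num.max (s0%:R * logplus (w (iter q (Pca c a) (crit false c))))
            (s1%:R * logplus (w (iter q (Pca c a) (crit true c)))).
Proof.
move=> hw w_nat w2 w3 /andP[s0p s0q] /andP[s1p s1q] q0.
pose M := Num.max 1 (Num.max (w c) (w a)).
have M1 : 1 <= M by rewrite le_max lexx.
have cM : w c <= M by rewrite !le_max lexx !orbT.
have aM : w a <= M by rewrite !le_max lexx !orbT.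
have p3 : 0 < (3%:R ^+ q : R)^-1 by rewrite invr_gt0 exprn_gt0.
rewrite maxr_pMr ?(ltW p3) // ![_^-1 * (_ * _)]mulrCA /green_s.
have dich i := green_dichotomy hw w_nat w2 w3 M1 cM aM i q.
set l0 := _^-1 * logplus (w (iter _ _ (crit false _))).
set l1 := _^-1 * logplus (w (iter _ _ (crit true _))).
set g0 := green _ false _ _; set g1 := green _ true _ _.
have D0 := dich false; have D1 := dich true; rewrite /= -/l0 -/l1 -/g0 -/g1 in D0 D1.
have lnM0 : 0 <= ln M by rewrite ln_ge0.
(* When [M = 1] the error term [3^-q * ln M] vanishes, and the dichotomy becomes an equality for
   each critical point. *)
have [MM|MM] := leP M 1.
  have lnM : ln M = 0 by apply/eqP; rewrite eq_le lnM0 andbT -ln1 ler_ln ?posrE //; lra.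
  rewrite lnM mulr0 in D0 D1.
  by have [-> ->] : g0 = l0 /\ g1 = l1 by split; lra.
(* A slow critical point contributes at most [s * 3^-q * ln M <= ln M], while the fast one
   contributes [t * ln M]. *)
have dom (s t : nat) (x : R) : (0 < t)%N -> (s <= 3 ^ q)%N ->
    x <= (3%:R ^+ q)^-1 * ln M -> s%:R * x <= t%:R * ln M.
  move=> t0 sq xle; apply: (@le_trans _ _ (ln M)); last first.
    by rewrite ler_peMl // ler1n.
  apply: le_trans (ler_wpM2l (ler0n _ s) xle) _.
  rewrite mulrA ler_piMl // ler_pdivrMr ?exprn_gt0 // mul1r -natrX ler_nat //.
have [i] := w_Pca_crit_max c a hw w_nat w2 w3.
have <- : M = Num.max (w c) (w a).
  by apply: max_r; move: MM; rewrite lt_max ltxx /= => /ltW.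
move=> /(green_fast hw w_nat w2 w3 M1 cM aM q0 MM).
case: i; rewrite -/g0 -/g1 -/l0 -/l1 => -[gM lM].
  case: D0 => [->|[/andP[_ gl] /andP[_ ll]]]; rewrite gM lM //.
  by rewrite !max_r // dom.
case: D1 => [->|[/andP[_ gl] /andP[_ ll]]]; rewrite gM lM //.
by rewrite !max_l // dom.
Qed.

(** * Excluded places and choice of the exponent *)

Lemma finitely_many_bad_places (R : realType) (L : fieldExtType rat) :
  exists S : seq (L -> R), forall v : L -> R, nontrivial_absval v ->
    (forall w, w \in S -> ~ equiv_absval w v) ->
    [/\ forall m : nat, v m%:R <= 1, v 2%:R = 1 & v 3%:R = 1].
Proof.
have [S1 h1] := finitely_many_arch_places R L.
have [S2 h2] := finitely_many_padic_places R L (isT : prime 2).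
have [S3 h3] := finitely_many_padic_places R L (isT : prime 3).
exists (S1 ++ S2 ++ S3) => v nv hS; have hv := nv.1.
have no S : {subset S <= S1 ++ S2 ++ S3} -> ~ exists2 w, w \in S & equiv_absval w v.
  by move=> sub [w /sub wS]; exact: hS.
have v2 : v 2%:R <= 1.
  rewrite leNgt; apply/negP => /(h1 v nv); apply: no => w wS.
  by rewrite !mem_cat wS.
have v_nat := absval_nat_le1 hv (isT : (1 < 2)%N) v2.
split=> //; apply/eqP; rewrite eq_le v_nat leNgt; apply/negP.
  by move=> /(h2 v nv); apply: no => w wS; rewrite !mem_cat wS orbT.
by move=> /(h3 v nv); apply: no => w wS; rewrite !mem_cat wS !orbT.
Qed.

Unset Implicit Arguments.

Theorem proposition3p11 (R : realType) (L : fieldExtType rat)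
    (F : {poly {poly L}}) (hF : abs_irreducible2 F)
    (s0 s1 : nat) (hs0 : (0 < s0)%N) (hs1 : (0 < s1)%N) :
  exists2 q : nat, (1 <= q)%N &
  exists S : seq (L -> R),
    forall v : L -> R, nontrivial_absval v ->
      (forall w, w \in S -> ~ equiv_absval w v) ->
      forall (K : fieldType) (w : K -> R) (iota : {rmorphism L -> K}),
        is_completion v w iota ->
        forall c a : K, eval2 (map_poly (map_poly iota) F) c a = 0 ->
          green_s w s0 s1 c a =
          (3%:R ^+ q)^-1 *
            Num.max (s0%:R * logplus (w (iter q (Pca c a) (crit false c))))
                    (s1%:R * logplus (w (iter q (Pca c a) (crit true c)))).
Proof.
have [S hS] := finitely_many_bad_places R L.
have le3 n m : (n <= 3 ^ (n + m))%N.
  by apply: leq_trans (leq_addr m n) (ltnW (ltn_expl _ _)).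
(* The exponent depends only on the weights: [3 ^ (s0 + s1)] is at least each of them. *)
exists (s0 + s1)%N; first by rewrite addn_gt0 hs0.
exists S => v nv nS K w iota [hw wv _ _] c a _.
have [v_nat v2 v3] := hS v nv nS.
have w_nat m : w m%:R = v m%:R by rewrite -wv rmorph_nat.
apply: green_s_formula; rewrite ?w_nat ?hs0 ?hs1 ?le3 //.
- by move=> m; rewrite w_nat.
- by rewrite addnC le3.
- by rewrite addn_gt0 hs0.
Qed.
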